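(* Let $P_n$ be the path with vertices $v_1,v_2,\dots,v_n$ (consecutive vertices adjacent), and let $S$ be a vertex set of $P_n$ whose complement $\overline{S}=\{v_{i_1},v_{i_2},\dots,v_{i_k}\}$, with $k\ge 1$ and $1<i_1<i_2<\cdots<i_k<n$, is isolated (no two vertices of $\overline S$ are adjacent). Let $S_{i_0}=\{v_1,\dots,v_{i_1-1}\}$, $S_{i_j}=\{v_{i_j+1},\dots,v_{i_{j+1}-1}\}$ for $1\le j\le k-1$, and $S_{i_k}=\{v_{i_k+1},\dots,v_n\}$. Let $m=|S_{i_0}|$, and let $M=|S_{i_1}|$ if $k\ge 2$, and $M=0$ if $k=1$ (no interior blocks). Then $S$ is a minimal perfect critical vertex set of $P_n$ if and only if all of the following hold: (i) $|S_{i_k}|=|S_{i_0}|$ and $|S_{i_1}|=|S_{i_2}|=\cdots=|S_{i_{k-1}}|$ (the latter being vacuous if $k=1$); (ii) $M=0$ or $M=2m$; (iii) $2m+1$ is an odd prime.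
   Context: $\mathbf{L}$ denotes the Laplacian matrix of a graph $G=(V,E)$ (degree matrix minus adjacency matrix). For $S\subset V$, $\overline{S}=V\setminus S$. For a vector $\mathbf{y}$ indexed by $V$, $\mathbf{y}|_S$ is the restriction of $\mathbf{y}$ to the coordinates in $S$. A nonempty $S\subset V$ is a critical vertex set if there is an eigenvector $\mathbf{y}$ of $\mathbf{L}$ with $\mathbf{y}|_{\overline S}=\mathbf{0}$. It is a perfect critical vertex set if there is an eigenvector $\mathbf{y}$ of $\mathbf{L}$ with $\mathbf{y}|_{\overline S}=\mathbf{0}$ and $\mathbf{y}|_{\{v\}}\neq 0$ for every $v\in S$. A perfect critical vertex set is minimal if no proper subset of it is a perfect critical vertex set. *)

(* Defs.v *)
From HB Require Import structures.
From mathcomp Require Import all_boot all_order all_algebra.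

Set Implicit Arguments.
Unset Strict Implicit.
Unset Printing Implicit Defensive.

Import GRing.Theory.

(* A graph with vertex set 'I_n is given by its adjacency relation
   (symmetric and irreflexive for a simple graph). *)

Section Laplacian.
Local Open Scope ring_scope.

Definition degree (n : nat) (e : rel 'I_n) (v : 'I_n) : nat :=
  #|[set w | e v w]|.

Definition degree_mx (R : fieldType) (n : nat) (e : rel 'I_n) : 'M[R]_n :=
  diag_mx (\row_v (degree e v)%:R).

Definition adjacency_mx (R : fieldType) (n : nat) (e : rel 'I_n) : 'M[R]_n :=
  \matrix_(u, v) (e u v)%:R.

Definition laplacian (R : fieldType) (n : nat) (e : rel 'I_n) : 'M[R]_n :=
  degree_mx R e - adjacency_mx R e.

(* Column-vector convention, unlike mathcomp's row-vector [eigenspace]. *)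
Definition eigenvector (R : fieldType) (n : nat) (A : 'M[R]_n) (y : 'cV[R]_n)
    : Prop :=
  y != 0 /\ exists a : R, A *m y = a *: y.

Definition perfect_critical (R : fieldType) (n : nat) (e : rel 'I_n)
    (S : {set 'I_n}) : Prop :=
  S != set0 /\
  exists y : 'cV[R]_n,
    [/\ eigenvector (laplacian R e) y,
        forall v, v \in ~: S -> y v ord0 = 0
      & forall v, v \in S -> y v ord0 != 0].

Definition minimal_perfect_critical (R : fieldType) (n : nat) (e : rel 'I_n)
    (S : {set 'I_n}) : Prop :=
  perfect_critical R e S /\
  forall T : {set 'I_n}, T \proper S -> ~ perfect_critical R e T.

End Laplacian.

Definition isolated (n : nat) (e : rel 'I_n) (A : {set 'I_n}) : Prop :=
  forall u v, u \in A -> v \in A -> ~~ e u v.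

(* The element u of 'I_n is the vertex v_(u+1) of the path v_1, ..., v_n. *)
Definition label (n : nat) (u : 'I_n) : nat := u.+1.

Definition path_graph (n : nat) : rel 'I_n :=
  fun u v => (label v == (label u).+1) || (label u == (label v).+1).
Arguments path_graph n : clear implicits.

(* For 1 <= k and indices i 1 < ... < i k (the values of i outside 1..k are
   irrelevant), the blocks S_(i_0), ..., S_(i_k) cut out by v_(i 1), ...,
   v_(i k): block 0 has no lower bound and block k has no upper bound. *)
Definition block (n k : nat) (i : nat -> nat) (j : nat) : {set 'I_n} :=
  [set v : 'I_n | ((j == 0) || (i j < label v)) &&
                  ((j == k) || (label v < i j.+1))].
Arguments block n k i j : clear implicits.

(* Main.v *)
(* Read along the path, an eigenvector satisfies a second-order recurrence
   x_(r+1) = c x_r - x_(r-1).  If x vanishes first at 0-based position m, the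
   recurrence makes x odd about m, while the left end makes it even about -1/2;
   hence x is antiperiodic with period d = 2m+1 and its zeros are exactly the r
   with d | 2r+1.  Evenness about n - 1/2 at the right end forces d | n.
   Conversely, for every odd d > 1 dividing n, x_r = cos ((2r+1) pi / (2d)) is
   an eigenvector with this zero set.  These zero sets are ordered by
   divisibility of d, so a minimal S corresponds to a prime d. *)
Require Import Defs.
From mathcomp Require Import all_boot all_order all_algebra reals.
From mathcomp Require Import zify ring trigo.

Set Implicit Arguments.
Unset Strict Implicit.
Unset Printing Implicit Defensive.

Import Order.TTheory GRing.Theory Num.Theory.

(** * Odd multiples of an odd modulus *)

(** With d = 2m+1 and t = r mod d, the odd number 2t+1 lies strictly between 0 and 2d, so d divides
    it only when 2t+1 = d. *)
Lemma dvdn_odd_modn m r : (m.*2.+1 %| r.*2.+1) = (r %% m.*2.+1 == m).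
Proof.
rewrite {1}(divn_eq r m.*2.+1); set q := (r %/ _).
have := ltn_pmod r (isT : (0 < m.*2.+1)); set t := (r %% _) => lt_t.
have -> : ((q * m.*2.+1 + t).*2.+1 = q.*2 * m.*2.+1 + t.*2.+1) by lia.
rewrite dvdn_addr ?dvdn_mull //; apply/idP/eqP => [/dvdnP[j Ej]|-> //].
by move: Ej; case: j => [|[|j]]; rewrite ?mulSn; lia.
Qed.

Lemma dvdn_oddP m r :
  reflect (exists q, r = q * m.*2.+1 + m) (m.*2.+1 %| r.*2.+1).
Proof.
rewrite dvdn_odd_modn; apply: (iffP eqP) => [mod_r | [q ->]].
  by exists (r %/ m.*2.+1); rewrite {1}(divn_eq r m.*2.+1) mod_r.
by rewrite modnMDl modn_small //; lia.
Qed.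

(** * Symmetries and zeros of the three-term recurrence *)

Section Recurrence.
Local Open Scope ring_scope.
Variables (R : numFieldType) (c : R) (x : nat -> R).
(** Since [0.-1 = 0], the case [r = 0] reads x_1 = c x_0 - x_0, as if x_(-1) = x_0. *)
Hypothesis x_rec : forall r, x r.+1 = c * x r - x r.-1.

Lemma rec_zero r : x 0%N = 0 -> x r = 0.
Proof.
move=> x0; suff: x r = 0 /\ x r.+1 = 0 by case.
elim: r => [|r [xr xr1]]; first by rewrite x_rec x0 mulr0 subr0.
by rewrite xr1 x_rec xr1 xr mulr0 subr0.
Qed.

Lemma rec_antisym m s : x m = 0 -> (s <= m)%N -> x (m + s)%N = - x (m - s)%N.
Proof.
move=> xm0.
(* The recurrence has order two, so the induction carries two consecutive offsets. *)
suff: ((s <= m)%N -> x (m + s)%N = - x (m - s)%N) /\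
      ((s < m)%N -> x (m + s.+1)%N = - x (m - s.+1)%N) by case.
elim: s => [|s [IH1 IH2]]; split => //.
- by rewrite addn0 subn0 xm0 oppr0.
- by move=> _; rewrite addn1 x_rec xm0 mulr0 sub0r subn1.
- move=> lt_s; rewrite addnS x_rec IH2 ?(ltnW lt_s) // addnS /= IH1; last by lia.
  have /eqP := x_rec (m - s.+1); have -> : (m - s.+1).+1 = (m - s)%N by lia.
  have -> : (m - s.+1).-1 = (m - s.+2)%N by lia.
  by move/eqP->; ring.
Qed.

(** Both sides obey the same recurrence in r, so agreement at r = 0 and r = 1 suffices; oddness
    about m and evenness about -1/2 give x_(2m) = x_(2m+1) = -x_0. *)
Lemma rec_antiperiodic m r : x m = 0 -> x (r + m.*2.+1)%N = - x r.
Proof.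
move=> xm0.
have x2m : x m.*2 = - x 0%N by rewrite -addnn rec_antisym // subnn.
have x2m1 : x m.*2.+1 = - x 0%N.
  case: m xm0 x2m => [|m] xm0 x2m; first by rewrite x_rec xm0 mulr0 sub0r.
  have := rec_antisym (s := m) xm0 (leqnSn m).
  have -> : (m.+1 + m)%N = m.*2.+1 by lia.
  rewrite subSnn => e; rewrite x_rec x2m doubleS /= e x_rec /=; ring.
suff: x (r + m.*2.+1)%N = - x r /\ x (r.+1 + m.*2.+1)%N = - x r.+1 by case.
elim: r => [|r [IH1 IH2]]; split => //.
  by rewrite add1n x_rec x2m1 /= x2m (x_rec 0) /=; ring.
by rewrite addSn x_rec IH2 addSn /= IH1 (x_rec r.+1) /=; ring.
Qed.

Lemma rec_antiperiodic_iter m q r :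
  x m = 0 -> x (r + q * m.*2.+1)%N = (-1) ^+ q * x r.
Proof.
move=> xm0; elim: q => [|q IH]; first by rewrite addn0 mul1r.
by rewrite mulSnr addnA rec_antiperiodic // IH exprS; ring.
Qed.

Lemma rec_reflect n s : x n = x n.-1 -> (s < n)%N -> x (n + s)%N = x (n - s.+1)%N.
Proof.
move=> xn.
suff: ((s < n)%N -> x (n + s)%N = x (n - s.+1)%N) /\
      ((s.+1 < n)%N -> x (n + s.+1)%N = x (n - s.+2)%N) by case.
elim: s => [|s [IH1 IH2]]; split => //.
- by rewrite addn0 subn1 xn.
- case: n xn => [|[|n]] //= xn _; rewrite addn1 x_rec xn /= !subSS subn0.
  by move: xn; rewrite x_rec /= => /eqP; rewrite subr_eq => /eqP ->; ring.
- move=> lt_s; rewrite addnS x_rec IH2 ?(ltnW lt_s) // addnS /= IH1; last by lia.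
  have := x_rec (n - s.+2); have -> : (n - s.+2).+1 = (n - s.+1)%N by lia.
  have -> : (n - s.+2).-1 = (n - s.+3)%N by lia.
  by move->; ring.
Qed.

(** Antiperiodicity reduces r to its residue t modulo 2m+1; a residue above m is reflected to 2m-t
    below m, where no zero occurs. *)
Lemma rec_zero_set m r : x m = 0 -> (forall s, (s < m)%N -> x s != 0) ->
  (x r == 0) = (m.*2.+1 %| r.*2.+1)%N.
Proof.
move=> xm0 xmin; rewrite dvdn_odd_modn {1}(divn_eq r m.*2.+1) addnC.
rewrite rec_antiperiodic_iter // mulf_eq0 signr_eq0 /=.
have := ltn_pmod r (isT : (0 < m.*2.+1)%N); set t := (r %% _)%N => lt_t.
case: (ltngtP t m) => [lt_tm|lt_mt|->]; last by rewrite xm0 eqxx.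
- exact/negbTE/xmin.
- have -> : t = (m + (t - m))%N by lia.
  rewrite rec_antisym //; last by lia.
  by rewrite oppr_eq0; apply/negbTE/xmin; lia.
Qed.

(** Reflection at the right end gives x_(n+m) = x_(n-m-1), antiperiodicity gives the opposite sign.
    Hence x_(n-m-1) = 0, so n-m-1 is congruent to m modulo 2m+1. *)
Lemma rec_period_dvd m n : x m = 0 -> (forall s, (s < m)%N -> x s != 0) ->
  (m < n)%N -> x n = x n.-1 -> (m.*2.+1 %| n)%N.
Proof.
move=> xm0 xmin lt_mn xn.
have: x (n - m.+1)%N == 0.
  have := rec_antiperiodic (n - m.+1) xm0.
  have -> : (n - m.+1 + m.*2.+1 = n + m)%N by lia.
  by rewrite rec_reflect // => /eqP; rewrite -addr_eq0 -mulr2n mulrn_eq0.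
rewrite (rec_zero_set _ xm0 xmin) dvdn_odd_modn => /eqP mod_m.
rewrite /dvdn; have -> : n = (n - m.+1 + m.+1)%N by lia.
by rewrite -modnDml mod_m -addSnnS addSn addnn modnn.
Qed.

(** Both entries equal (-1)^q x_0, because x_(2m) = -x_0. *)
Lemma rec_boundary m q : x m = 0 -> (0 < q)%N ->
  x (q * m.*2.+1)%N = x (q * m.*2.+1).-1.
Proof.
move=> xm0; case: q => // q _.
have -> : (q.+1 * m.*2.+1).-1 = (m.*2 + q * m.*2.+1)%N by lia.
rewrite -[(q.+1 * _)%N]add0n !rec_antiperiodic_iter // exprS.
by rewrite -addnn rec_antisym // subnn; ring.
Qed.

End Recurrence.

(** * Laplacian eigenvectors of the path and their zero sets *)

Section PathLaplacian.
Local Open Scope ring_scope.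

Lemma laplacian_mul (R : fieldType) n (e : rel 'I_n) (y : 'cV[R]_n) v :
  (laplacian R e *m y) v ord0 = \sum_(w | e v w) (y v ord0 - y w ord0).
Proof.
rewrite mulmxBl mul_diag_mx !mxE sumrB sumr_const -[y v ord0 *+ _]mulr_natl.
congr (_%:R * _ - _); first by apply: eq_card => w; rewrite inE.
rewrite [RHS]big_mkcond; apply: eq_bigr => w _; rewrite mxE.
by case: (e v w); rewrite ?mul1r ?mul0r.
Qed.

Lemma path_graph_sum (R : fieldType) n (F : nat -> R) (v : 'I_n) :
  \sum_(w | path_graph n v w) F w =
  (if (0 < v)%N then F v.-1 else 0) + (if (v.+1 < n)%N then F v.+1 else 0).
Proof.
have single (P : pred 'I_n) k : (forall w : 'I_n, P w = (w == k :> nat)) ->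
    \sum_(w | P w) F w = if (k < n)%N then F k else 0.
  move=> Pk; case: ltnP => [lt_kn|le_nk].
    rewrite (big_pred1 (Ordinal lt_kn)) // => w; exact: Pk.
  rewrite big_pred0 // => w; rewrite Pk; have := ltn_ord w; lia.
rewrite (bigID (fun w : 'I_n => (w < v)%N)) /=; congr (_ + _).
  case: posnP => [v0|v_gt0].
    by apply: big_pred0 => w; rewrite v0 ltn0 andbF.
  rewrite (single _ v.-1) => [|w].
    by have -> : (v.-1 < n)%N by have := ltn_ord v; lia.
  by rewrite /path_graph /label; lia.
by apply: single => w; rewrite /path_graph /label; lia.
Qed.

(* At the left end [v = 0] the term [x v - x v.-1] vanishes since
   [0.-1 = 0]: this is how the recurrences [x r.+1 = c * x r - x r.-1] encode
   the left boundary condition. *)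
Lemma laplacian_path (R : fieldType) n (x : nat -> R) (v : 'I_n) :
  (laplacian R (path_graph n) *m \col_w x w) v ord0 =
  (x v - x v.-1) + (if (v.+1 < n)%N then x v - x v.+1 else 0).
Proof.
rewrite laplacian_mul mxE.
under eq_bigr => w _ do rewrite mxE.
rewrite (path_graph_sum (fun w => x v - x w)); congr (_ + _).
by case: posnP => // ->; rewrite subrr.
Qed.

Lemma rec_eigenvector (R : numFieldType) n (c : R) (x : nat -> R) :
  (forall r, x r.+1 = c * x r - x r.-1) -> (0 < n)%N -> x 0%N != 0 ->
  x n = x n.-1 ->
  eigenvector (laplacian R (path_graph n)) (\col_v x v).
Proof.
move=> x_rec n_gt0 x0 xn; split.
  apply: contraNneq x0 => /colP/(_ (Ordinal n_gt0)).
  by rewrite !mxE /= => ->.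
(* The recurrence turns 2x_v - x_(v-1) - x_(v+1) into (2-c) x_v; at the last vertex the missing
   difference is zero by [x n = x n.-1]. *)
exists (2 - c); apply/colP => v; rewrite laplacian_path !mxE.
have -> : (if (v.+1 < n)%N then x v - x v.+1 else 0) = x v - x v.+1.
  case: ltnP => // le_nv; have -> : v.+1 = n by have := ltn_ord v; lia.
  by rewrite xn; have -> : n.-1 = v by [have := ltn_ord v; lia]; rewrite subrr.
by rewrite x_rec; ring.
Qed.

(** The pair (x_r, x_(r+1)) of the solution with x_0 = a; x_r is a V_r(c/2), with V_r the Chebyshev
    polynomial of the third kind. *)
Fixpoint cheb (R : nzRingType) (c a : R) (r : nat) : R * R :=
  if r is r'.+1 then let: (p, q) := cheb c a r' in (q, c * q - p)
  else (a, c * a - a).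

Lemma cheb_rec (R : nzRingType) (c a : R) r :
  (cheb c a r.+1).1 = c * (cheb c a r).1 - (cheb c a r.-1).1.
Proof.
have cheb2 s : (cheb c a s).2 = (cheb c a s.+1).1 by rewrite /=; case: cheb.
case: r => // r; rewrite -cheb2 /=.
by case: cheb.
Qed.

Lemma eigenvector_rec (R : numFieldType) n (y : 'cV[R]_n) :
  (0 < n)%N -> eigenvector (laplacian R (path_graph n)) y ->
  exists c x, [/\ forall r, x r.+1 = c * x r - x r.-1, x 0%N != 0,
    x n = x n.-1 & forall v : 'I_n, y v ord0 = x v].
Proof.
move=> n_gt0 [y_neq0 [a Ay]].
pose z r := if insub r is Some v then y v ord0 else 0.
have zE (v : 'I_n) : y v ord0 = z v by rewrite /z valK.
have yE : y = \col_v z v by apply/colP => v; rewrite mxE.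
have zeq (v : 'I_n) :
    (z v - z v.-1) + (if (v.+1 < n)%N then z v - z v.+1 else 0) = a * z v.
  by rewrite -laplacian_path -yE Ay mxE zE.
(* Unlike the extension [z] by zero, [x] obeys the recurrence at every index; the two agree below
   [n]. *)
pose x r := (cheb (2 - a) (z 0%N) r).1.
have x_rec : forall r, x r.+1 = (2 - a) * x r - x r.-1 := cheb_rec _ _.
have zx r : (r < n)%N -> z r = x r.
  elim/ltn_ind: r => [[|r]] IH lt_rn //.
  have lt_rn' := ltnW lt_rn.
  have := zeq (Ordinal lt_rn'); rewrite /= lt_rn x_rec -!IH //; try lia.
  move=> /eqP; rewrite -subr_eq0 => /eqP zr; apply/eqP.
  by rewrite -subr_eq0 -oppr_eq0 -zr; apply/eqP; ring.
exists (2 - a), x; split=> // [||v]; last by rewrite zE zx.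
  apply: contra_neq y_neq0 => x0; apply/colP => v.
  by rewrite zE zx // (rec_zero x_rec _ x0) mxE.
(* Comparing the eigenvalue equation at the last vertex with the recurrence there yields the right
   boundary condition. *)
have lt_n1 : (n.-1 < n)%N by rewrite prednK.
have := zeq (Ordinal lt_n1); rewrite /= prednK // ltnn addr0 !zx //; last by lia.
have := x_rec n.-1; rewrite prednK // => -> e.
by rewrite mulrBl -e; ring.
Qed.

Lemma perfect_critical_dvd (R : numFieldType) n (T : {set 'I_n}) :
  perfect_critical R (path_graph n) T -> T != [set: 'I_n] ->
  exists m, [/\ (0 < m)%N, (m.*2.+1 %| n)%N &
    forall v, (v \in T) = ~~ (m.*2.+1 %| v.*2.+1)%N].
Proof.
move=> [_ [y [y_eig y_out y_in]]] T_proper.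
have [v vT] : exists v, v \notin T.
  by apply/existsP; apply: contraNT T_proper => /existsPn T_all;
     apply/eqP/setP => v; rewrite inE -[_ \in _]negbK T_all.
have n_gt0 : (0 < n)%N by have := ltn_ord v; lia.
have [c [x [x_rec x0 xn yx]]] := eigenvector_rec n_gt0 y_eig.
have xv : x v == 0 by rewrite -yx y_out // inE.
(* The parameter [m] is the first zero of the extended eigenvector; it exists because some vertex
   lies outside [T]. *)
have ex : exists r, x r == 0 by exists v.
have [m /eqP xm m_min] := ex_minnP ex.
have xmin s : (s < m)%N -> x s != 0.
  by move=> lt_sm; apply/negP => /m_min; lia.
exists m; split.
- by rewrite lt0n; apply: contra_neq x0 => m0; rewrite -{1}m0.
- apply: (rec_period_dvd x_rec xm xmin _ xn).
  by apply: leq_ltn_trans (m_min _ xv) (ltn_ord v).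
- move=> w; rewrite -(rec_zero_set x_rec _ xm xmin) -yx.
  apply/idP/idP => [|]; first exact: y_in.
  by apply: contraNT => wT; rewrite y_out // inE.
Qed.

Lemma dvd_perfect_critical (R : realType) n m :
  (0 < m)%N -> (0 < n)%N -> (m.*2.+1 %| n)%N ->
  perfect_critical R (path_graph n) [set v : 'I_n | ~~ (m.*2.+1 %| v.*2.+1)%N].
Proof.
move=> m_gt0 n_gt0 dvd_n.
pose t : R := pi / 2 / m.*2.+1%:R.
pose x r := cos (r.*2.+1%:R * t).
have t_gt0 : 0 < t by rewrite !divr_gt0 ?pi_gt0 ?ltr0n.
have x_rec r : x r.+1 = 2 * cos (2 * t) * x r - x r.-1.
  have xS : x r.+1 = cos (r.*2.+1%:R * t + 2 * t).
    by rewrite /x; congr cos; rewrite doubleS -[r.*2.+3]addn2 natrD; ring.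
  have xP : x r.-1 = cos (r.*2.+1%:R * t - 2 * t).
    (* At [r = 0] the predecessor is again 0, and evenness of cosine gives cos t = cos (t - 2t). *)
    case: r {xS} => [|r]; rewrite /x /=.
      by rewrite -cosN; congr cos; rewrite double0; ring.
    by congr cos; rewrite doubleS -[r.*2.+3]addn2 natrD; ring.
  by rewrite xS xP cosD cosB /x; ring.
have xm : x m = 0.
  by rewrite /x /t mulrC divfK ?cos_pihalf // pnatr_eq0.
have xmin s : (s < m)%N -> x s != 0.
  move=> lt_sm; apply/lt0r_neq0/cos_gt0_pihalf.
  have pos : 0 < s.*2.+1%:R * t by rewrite mulr_gt0 ?ltr0n.
  apply/andP; split.
    by apply: lt_trans pos; rewrite oppr_lt0 divr_gt0 ?pi_gt0.
  have -> : pi / 2 = m.*2.+1%:R * t :> R by rewrite /t [RHS]mulrC divfK // pnatr_eq0.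
  by rewrite ltr_pM2r // ltr_nat; lia.
have zeroE := rec_zero_set x_rec _ xm xmin.
split.
  apply/set0Pn; exists (Ordinal n_gt0); rewrite inE /= dvdn1; lia.
exists (\col_v x v); split.
- apply: (rec_eigenvector x_rec n_gt0 (xmin _ m_gt0)).
  have /dvdnP[q nE] := dvd_n; rewrite nE; apply: (rec_boundary x_rec xm); lia.
- by move=> v; rewrite !inE negbK -zeroE mxE => /eqP.
- by move=> v; rewrite inE -zeroE mxE.
Qed.

End PathLaplacian.

(** * Sizes of the blocks *)

Section BlockCard.

Lemma card_ord_interval n a b :
  #|[set v : 'I_n | a <= v < b]| = minn b n - a.
Proof.
rewrite cardsE cardE size_filter -(count_map val (fun r => a <= r < b)) -enumT.
rewrite val_enum_ord; elim: n => [|n IH]; first by rewrite minn0 sub0n.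
by rewrite -addn1 iotaD count_cat IH /=; lia.
Qed.

Variables (n k : nat) (i : nat -> nat).

Lemma card_block_first : 1 <= k -> i 1 <= n -> #|block n k i 0| = i 1 - 1.
Proof.
move=> k_ge1 le_i1.
have -> : block n k i 0 = [set v : 'I_n | 0 <= v < (i 1).-1].
  by apply/setP => v; rewrite !inE /label; lia.
by rewrite card_ord_interval; lia.
Qed.

Lemma card_block_last : 1 <= k -> #|block n k i k| = n - i k.
Proof.
move=> k_ge1.
have -> : block n k i k = [set v : 'I_n | i k <= v < n].
  by apply/setP => v; have := ltn_ord v; rewrite !inE /label; lia.
by rewrite card_ord_interval; lia.
Qed.

Lemma card_block_inner j :
  1 <= j < k -> i j.+1 <= n -> #|block n k i j| = i j.+1 - i j - 1.
Proof.
move=> j_in le_ij.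
have -> : block n k i j = [set v : 'I_n | i j <= v < (i j.+1).-1].
  by apply/setP => v; rewrite !inE /label; lia.
by rewrite card_ord_interval; lia.
Qed.

End BlockCard.

(** * Removed vertices as an arithmetic progression *)

Lemma incr_lt k (i : nat -> nat) : (forall j, 1 <= j < k -> i j < i j.+1) ->
  forall j l, 1 <= j -> j < l -> l <= k -> i j < i l.
Proof.
move=> i_incr j l j_ge1; elim: l => // l IH; rewrite ltnS leq_eqVlt.
case/predU1P => [<- lt_k | lt_jl lt_k]; first by apply: i_incr; rewrite j_ge1.
by apply: ltn_trans (IH lt_jl (ltnW lt_k)) (i_incr _ _); lia.
Qed.

(** With d = 2m+1, the increasing sequence [i] lists exactly the numbers qd+m+1 up to n, so it
    starts at q = 0 and skips no q; as n = Qd, the last one has q = Q-1. *)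
Lemma odd_multiples_enum n k m (i : nat -> nat) :
  1 <= k -> 1 < i 1 -> (forall j, 1 <= j < k -> i j < i j.+1) -> i k < n ->
  m.*2.+1 %| n ->
  (forall r, r < n ->
     m.*2.+1 %| r.*2.+1 <-> exists j, 1 <= j <= k /\ r.+1 = i j) ->
  [/\ i 1 = m.+1, forall j, 1 <= j < k -> i j.+1 = i j + m.*2.+1
    & n = i k + m].
Proof.
move=> k_ge1 i1_gt1 i_incr ik_lt /dvdnP[Q nE] iP.
have i_lt := incr_lt i_incr.
have i_le j l : 1 <= j -> j <= l -> l <= k -> i j <= i l.
  move=> j_ge1; rewrite leq_eqVlt => /predU1P[-> // | lt_jl] le_lk.
  exact/ltnW/i_lt.
have iE j : 1 <= j <= k -> exists q, i j = (q * m.*2.+1 + m).+1.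
  move=> j_in; have ij_gt0 : 0 < i j by have := i_le 1 j; lia.
  have lt_n : (i j).-1 < n by have := i_le j k; lia.
  have /(iP _ lt_n)/dvdn_oddP[q qE] :
      exists l, 1 <= l <= k /\ (i j).-1.+1 = i l by exists j; rewrite prednK.
  by exists q; rewrite -qE prednK.
have mem q : q * m.*2.+1 + m < n ->
    exists j, 1 <= j <= k /\ (q * m.*2.+1 + m).+1 = i j.
  by move=> lt_n; apply/iP => //; apply/dvdn_oddP; exists q.
have gap q r j l : i j = (q * m.*2.+1 + m).+1 -> i l = (r * m.*2.+1 + m).+1 ->
    i j < i l -> q < r.
  by move=> -> ->; rewrite ltnS ltn_add2r ltn_pmul2r.
have n_gt0 : 0 < Q by case: Q nE => //; lia.
split.
- have [q qE] := iE 1 (introT andP (conj isT k_ge1)).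
  have [|j [j_in jE]] := mem 0; first by nia.
  by have := i_le 1 j; nia.
- move=> j j_in.
  have [q qE] : exists q, i j = (q * m.*2.+1 + m).+1 by apply: iE; lia.
  have [r rE] : exists r, i j.+1 = (r * m.*2.+1 + m).+1 by apply: iE; lia.
  have lt_qr := gap _ _ _ _ qE rE (i_incr _ j_in).
  have le_S : q.+1 * m.*2.+1 <= r * m.*2.+1 by rewrite leq_pmul2r.
  (* The next term of the progression is some [i l]; monotonicity forces l > j, so [i j.+1] cannot
     exceed it. *)
  have [|l [l_in lE]] := mem q.+1; first by have := i_le j.+1 k; lia.
  have [le_lj|lt_jl] := leqP l j; first by have := i_le l j; lia.
  by have := i_le j.+1 l; lia.
- have [q qE] := iE k (introT andP (conj k_ge1 (leqnn k))).
  have lt_qQ : q < Q by rewrite -(ltn_pmul2r (isT : 0 < m.*2.+1)) -nE; lia.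
  have le_S : q.+1 * m.*2.+1 <= Q * m.*2.+1 by rewrite leq_pmul2r.
  move: lt_qQ; rewrite leq_eqVlt => /predU1P[QE|lt_SQ].
    by rewrite nE -QE qE; lia.
  (* If q+1 < Q, the term for q+1 would still fit below n and be listed beyond [i k]. *)
  have le_SS : q.+2 * m.*2.+1 <= Q * m.*2.+1 by rewrite leq_pmul2r.
  have [|l [l_in lE]] := mem q.+1; first by lia.
  by have := i_le l k; lia.
Qed.

Lemma arith_odd_multiples n k m (i : nat -> nat) :
  1 <= k -> i 1 = m.+1 -> (forall j, 1 <= j < k -> i j.+1 = i j + m.*2.+1) ->
  n = i k + m ->
  n = k * m.*2.+1 /\
  (forall r, r < n ->
     m.*2.+1 %| r.*2.+1 <-> exists j, 1 <= j <= k /\ r.+1 = i j).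
Proof.
move=> k_ge1 i1 iS nE.
have iE j : j < k -> i j.+1 = (j * m.*2.+1 + m).+1.
  elim: j => [|j IH] lt_jk; first by rewrite i1.
  by rewrite iS ?IH; lia.
have {}nE : n = k * m.*2.+1.
  by rewrite nE -[in i k](prednK k_ge1) iE; nia.
split=> // r lt_rn; split => [/dvdn_oddP[q qE] | [[|j] [j_in jE]]] //.
  have lt_qk : q < k by rewrite -(ltn_pmul2r (isT : 0 < m.*2.+1)) -nE; lia.
  by exists q.+1; rewrite iE // qE.
by apply/dvdn_oddP; exists j; move: jE; rewrite iE; lia.
Qed.

(** * Minimality and primality *)

Theorem theorem3 (R : realType) (n k : nat) (i : nat -> nat) (S : {set 'I_n})
    (k_ge1 : 1 <= k)
    (i_first : 1 < i 1%N)
    (i_incr : forall j : nat, 1 <= j < k -> i j < i j.+1)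
    (i_last : i k < n)
    (compl_S : forall v : 'I_n,
       v \in ~: S <-> exists j : nat, 1 <= j <= k /\ label v = i j)
    (isolated_compl : isolated (path_graph n) (~: S)) :
  let m := #|block n k i 0| in
  let M := if 2 <= k then #|block n k i 1| else 0 in
  minimal_perfect_critical R (path_graph n) S <->
  [/\ #|block n k i k| = #|block n k i 0| /\
      (forall j : nat, 1 <= j <= k - 1 -> #|block n k i j| = #|block n k i 1|),
      M = 0 \/ M = 2 * m
    & prime (2 * m + 1) /\ odd (2 * m + 1)].
have i_lt := incr_lt i_incr.
have i1_le : i 1 <= i k.
  have [->//|lt_1k] : k = 1 \/ 1 < k by lia.
  exact/ltnW/i_lt.
have S_neqT : S != [set: 'I_n].
  have lt_n : (i 1).-1 < n by lia.
  have : Ordinal lt_n \in ~: S.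
    by apply/compl_S; exists 1; rewrite /label /=; split; lia.
  by rewrite inE; apply: contraNneq => ->; rewrite inE.
have inner_le j : 1 <= j < k -> i j.+1 <= n.
  move=> j_in; have [->|lt_jk] : j.+1 = k \/ j.+1 < k by lia.
    exact: ltnW.
  by have := i_lt j.+1 k; lia.
have cardF : #|block n k i 0| = i 1 - 1 by apply: card_block_first; lia.
have cardL : #|block n k i k| = n - i k by apply: card_block_last.
have cardI j : 1 <= j < k -> #|block n k i j| = i j.+1 - i j - 1.
  by move=> j_in; apply: card_block_inner => //; apply: inner_le.
move=> m M; rewrite {}/M {}/m cardF cardL.
split=> [[S_perf S_min] | [[last_eq inner_eq] M_eq [d_prime _]]].
- have [m [m_gt0 dvd_n memS]] := perfect_critical_dvd S_perf S_neqT.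
  have [|i1 iS nE] := odd_multiples_enum k_ge1 i_first i_incr i_last dvd_n.
    move=> r lt_rn; rewrite -(compl_S (Ordinal lt_rn)) inE memS negbK.
    exact: iff_refl.
  have cardI' j : 1 <= j <= k - 1 -> #|block n k i j| = m.*2.
    by move=> j_in; rewrite cardI ?iS; lia.
  split.
  + by split=> [|j j_in]; [lia | rewrite !cardI' //; lia].
  + by case: ifP => [k_ge2|_]; [right; rewrite cardI'; lia | left].
  have -> : 2 * (i 1 - 1) + 1 = m.*2.+1 by lia.
  split; last by rewrite /= odd_double.
  (* If 2m+1 is not prime, its least prime factor p = 2q+1 yields a smaller perfect critical set:
     odd multiples of 2m+1 are odd multiples of p, and vertex [q] belongs to [S] but not to the new
     set. *)
  pose p := pdiv m.*2.+1; pose q := p./2.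
  have p_prime : prime p by apply: pdiv_prime; lia.
  have pE : p = q.*2.+1.
    have p_odd : odd p by apply: dvdn_odd (pdiv_dvd _) _; rewrite /= odd_double.
    by rewrite -[p]odd_double_half p_odd.
  have q_gt0 : 0 < q by have := prime_gt1 p_prime; lia.
  have [->|p_neq] := eqVneq m.*2.+1 p; first exact: p_prime.
  have p_dvd : q.*2.+1 %| m.*2.+1 by rewrite -pE pdiv_dvd.
  have p_le := dvdn_leq (isT : 0 < m.*2.+1) p_dvd.
  have n_gt0 : 0 < n by lia.
  have := dvd_perfect_critical R q_gt0 n_gt0 (dvdn_trans p_dvd dvd_n).
  case/S_min; apply/properP; split.
    apply/subsetP => v; rewrite inE memS; apply: contra.
    exact: dvdn_trans.
  have lt_qn : q < n by lia.
  exists (Ordinal lt_qn); last by rewrite inE negbK /= dvdnn.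
  rewrite memS /=; apply/negP => /(dvdn_leq (isT : 0 < q.*2.+1)); lia.
- set m := i 1 - 1 in last_eq M_eq d_prime.
  have m_gt0 : 0 < m by rewrite /m; lia.
  have dE : 2 * m + 1 = m.*2.+1 by lia.
  (* Isolation makes the first interior block nonempty, which for k > 1 leaves only M = 2m. *)
  have gap_gt1 : 1 < k -> (i 1).+1 < i 2.
    move=> k_gt1; have i12 : i 1 < i 2 by apply: i_incr.
    have i2_le := inner_le 1 k_gt1.
    have lt1 : (i 1).-1 < n by lia.
    have lt2 : (i 2).-1 < n by lia.
    rewrite ltn_neqAle i12 andbT; apply/eqP => i2E.
    have := isolated_compl (Ordinal lt1) (Ordinal lt2).
    rewrite /path_graph /label /= !prednK; try lia.
    rewrite i2E eqxx /= => isol.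
    suff: false by []; apply: isol; apply/compl_S.
      by exists 1; rewrite /label /=; split; lia.
    by exists 2; rewrite /label /=; split; lia.
  have [|||nE iP] := @arith_odd_multiples n k m i k_ge1; try by lia.
    move=> j j_in; have k_gt1 : 1 < k by lia.
    have /inner_eq : 1 <= j <= k - 1 by lia.
    move: M_eq (gap_gt1 k_gt1) (i_incr _ j_in).
    by rewrite k_gt1 !cardI //; lia.
  have memS v : (v \in S) = ~~ (m.*2.+1 %| v.*2.+1).
    apply/idP/idP => [vS | ndvd].
      apply: contraL vS => dvd_v; rewrite -in_setC; apply/compl_S.
      exact/(iP _ (ltn_ord v)).
    apply: contraR ndvd; rewrite -in_setC => /compl_S.
    by move/(iP _ (ltn_ord v)).
  have n_gt0 : 0 < n by lia.
  have dvd_n : m.*2.+1 %| n by rewrite nE dvdn_mull.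
  split.
    have -> : S = [set v : 'I_n | ~~ (m.*2.+1 %| v.*2.+1)].
      by apply/setP => v; rewrite memS inE.
    exact: dvd_perfect_critical.
  move=> T T_prop T_perf.
  have T_neqT : T != [set: 'I_n].
    apply: contraTneq T_prop => ->; rewrite properE negb_and.
    by rewrite subsetT orbT.
  have [m2 [m2_gt0 _ memT]] := perfect_critical_dvd T_perf T_neqT.
  (* Vertex [m] is outside [S], hence outside [T], so 2[m2]+1 divides the prime 2m+1; then [m2] = m
     and [T] = [S], against properness. *)
  have lt_mn : m < n by lia.
  have : Ordinal lt_mn \notin T.
    by apply/negP => /(subsetP (proper_sub T_prop)); rewrite memS dvdnn.
  rewrite memT negbK /= -dE => dvd_m2.
  move/primeP: d_prime => [_ /(_ _ dvd_m2)] /orP[]/eqP m2E; first by lia.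
  have ST : T = S.
    by apply/setP => v; rewrite memS memT m2E dE.
  by rewrite ST properxx in T_prop.
Qed.
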